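(* With the notation of the context, the criterion $J_n^{\mathrm{prob}}(x_{n+1})=\left|\mathbb{E}_{G_{n+1}}\left(\Gamma_{n+1}(x_{n+1})\right)-(1-\alpha)\right|$ satisfies $$\begin{aligned}J^{\mathrm{prob}}_{n}(x_{n+1})=\Bigg|\int_{\mathbb{X}}\sum_{i=1}^{L-1}\Bigg[&\Phi_{r_n^i}\left(e_n^i(x_{n+1};x),f_n^i(x_{n+1},I_{i+1})\right)-\Phi_{r_n^i}\left(e_n^i(x_{n+1};x),f_n^i(x_{n+1},I_i)\right)\\&+\Phi_{r_n^i}\left(e_n^i(x_{n+1};x),f_n^i(x_{n+1},I_1)\right)+\Phi_{-r_n^i}\left(e_n^i(x_{n+1};x),-f_n^i(x_{n+1},I_L)\right)\Bigg]dx-(1-\alpha)\Bigg|,\end{aligned}$$ where $$e_n^i(x_{n+1};x)=e_n^i(x_{n+1};x;x_{n+1}^q(B_i))=\frac{m_n(x)-m_n(x_{n+1}^q(B_i))}{\sigma_W},\qquad f_n^i(x_{n+1},I_i)=I_i\,s_n(x_{n+1}),$$ (and likewise $f_n^i(x_{n+1},t)=t\,s_n(x_{n+1})$ for $t=I_{i+1},I_1,I_L$), $$\sigma_W=s_n(x)^2+\frac{k_n(x_{n+1}^q(B_i),x_{n+1})^2}{s_n(x_{n+1})^2}-2\,\frac{k_n(x_{n+1}^q(B_i),x_{n+1})\,k_n(x,x_{n+1})}{s_n(x_{n+1})^2},$$ and $\Phi_{r_n^i}$ is the cumulative distribution function of the centered Gaussian law with covariance matrix $\begin{pmatrix}1&r_n^i\\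 r_n^i&1\end{pmatrix}$, with $$r_n^i=\frac{k_n(x_{n+1}^q(B_i),x_{n+1})-k_n(x,x_{n+1})}{\sqrt{s_n(x)^2+\frac{k_n(x_{n+1}^q(B_i),x_{n+1})^2}{s_n(x_{n+1})^2}-2\,\frac{k_n(x_{n+1}^q(B_i),x_{n+1})\,k_n(x,x_{n+1})}{s_n(x_{n+1})^2}}\;s_n(x_{n+1})}.$$
   Context: Gaussian process model. A function $g:\mathbb{X}\subset\mathbb{R}^d\to\mathbb{R}$ is modelled as a realization of a Gaussian process $G$ on $\mathbb{X}$ with known mean and covariance function. Given observations $\mathcal{A}_n=\{(x_1,g_1),\dots,(x_n,g_n)\}$ with $g_i=g(x_i)$, the conditional law of $G$ given $\mathcal{A}_n$ is that of a Gaussian process with mean $m_n(x)=\mathbb{E}(G(x)\mid\mathcal{A}_n)$ and covariance $k_n(x,x')=\mathrm{Cov}(G(x),G(x')\mid\mathcal{A}_n)$; $s_n^2(x)=k_n(x,x)$. For a candidate point $x_{n+1}\in\mathbb{X}$ with observed value $g_{n+1}$, the updated conditional mean is $m_{n+1}(x)=m_n(x)+k_n(x_{n+1},x)\,z$ with $z=\frac{g_{n+1}-m_n(x_{n+1})}{s_n^2(x_{n+1})}$. Percentile points. The input $X$ is a random vector with values in $\mathbb{X}$, and $\alpha\in\,]0,1[$ is a fixed level. Let $x_{MC}^1,\dots,x_{MC}^l$ be an independent sample distributed as $X$. At step $n$ the estimator $q_n$ of the $\alpha$-percentile is the $(\lfloor l\alpha\rfloor+1)$-th smallest of the values $m_n(x_{MC}^1),\dots,m_n(x_{MC}^l)$;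 $q_{n+1}$ is defined in the same way from $m_{n+1}$. For fixed $x_{n+1}$ put $b_j=m_n(x_{MC}^j)$, $a_j=k_n(x_{MC}^j,x_{n+1})$, so that $m_{n+1}(x_{MC}^j)=b_j+a_jz$ is a straight line in $z$. There are at most $L=\frac{l(l-1)}{2}$ intersection points of these lines, with abscissae denoted $I_1,\dots,I_L$ in increasing order; $I_0=-\infty$, $I_{L+1}=+\infty$, and $B_i=[I_i,I_{i+1}]$ for $0\le i\le L$. For $z\in B_i$ the order of the lines is fixed; if $j_i$ is the index of the $(\lfloor l\alpha\rfloor+1)$-th lowest line on $B_i$, the percentile point of $B_i$ is $x_{n+1}^q(B_i)=x_{MC}^{j_i}$. Thus $q_{n+1}=\sum_{i=0}^{L}m_{n+1}(x_{n+1}^q(B_i))\mathbf{1}_{z\in B_i}$. In the claim, $B_i$ and $L$ denote the effective intervals and number of intervals, that is, the intervals for which the percentile points are different. Criterion. The unknown value $g_{n+1}$ is replaced by the random variable $G_{n+1}=G(x_{n+1})$, distributed according to its law conditional on $\mathcal{A}_n$, and $A_{n+1}=\mathcal{A}_n\cup(x_{n+1},G_{n+1})$. Then $$\Gamma_{n+1}(x_{n+1})=\int_{\mathbb{X}}\mathbb{P}\left(G(x)\ge q_{n+1}\mid A_{n+1}\right)dx,$$ and $\mathbb{E}_{G_{n+1}}$ is the expectation over $G_{n+1}$.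
   Formalization: The two tail terms stand outside the sum, once each, with e, r of index 0 (at I_1) and L (at -I_L); sigma_W is the square root of the printed expression; assumed: at least one effective breakpoint (L>=1), s_n(x_{n+1})>0 and sigma_W>0 for almost every x. *)

(* Defs.v *)
From HB Require Import structures.
From mathcomp Require Import all_boot all_order all_algebra.
From mathcomp Require Import all_classical all_reals all_analysis.

Set Implicit Arguments.
Unset Strict Implicit.
Unset Printing Implicit Defensive.

Import Order.TTheory GRing.Theory Num.Theory.
Import numFieldNormedType.Exports.

Local Open Scope classical_set_scope.
Local Open Scope ring_scope.

Section tuple_measure.
Local Open Scope ereal_scope.
Context d (T : measurableType d) (R : realType).
Variable mu : {sigma_finite_measure set T -> \bar R}.

Definition cons_pair n (p : T * n.-tuple T) : n.+1.-tuple T :=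
  [tuple of p.1 :: p.2].

Lemma measurable_cons_pair n : measurable_fun [set: T * n.-tuple T] (@cons_pair n).
Proof. exact: measurable_cons. Qed.

Lemma tnth_cons_pairS n (x : T) (t : n.-tuple T) (i : 'I_n) :
  tnth (cons_pair (x, t)) (lift ord0 i) = tnth t i.
Proof. by rewrite !(tnth_nth x). Qed.

Section succ.
Variables (n : nat) (nu : {sigma_finite_measure set (n.-tuple T) -> \bar R}).

Definition tuple_measureS : set (n.+1.-tuple T) -> \bar R :=
  pushforward (mu \x nu) (@cons_pair n).


Let pf : {measure set (n.+1.-tuple T) -> \bar R} :=
  measure_function_pushforward__canonical__measure_function_Measure
    (mu \x nu) (@measurable_cons_pair n).

Let tuple_measureS0 : tuple_measureS set0 = 0.
Proof. exact: (measure0 pf). Qed.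

Let tuple_measureS_ge0 A : 0 <= tuple_measureS A.
Proof. exact: (measure_ge0 pf). Qed.

Let tuple_measureS_sigma_additive : semi_sigma_additive tuple_measureS.
Proof. exact: (@measure_semi_sigma_additive _ _ _ pf). Qed.

HB.instance Definition _ := isMeasure.Build _ _ _ tuple_measureS
  tuple_measureS0 tuple_measureS_ge0 tuple_measureS_sigma_additive.

Let tuple_measureS_sigma_finite : sigma_finite setT tuple_measureS.
Proof.
have /sigma_finiteP[F [TF ndF Foo]] := sigma_finiteT mu.
have /sigma_finiteP[H [TH ndH Hoo]] := sigma_finiteT nu.
pose uncons (t : n.+1.-tuple T) : T * n.-tuple T :=
  (tnth t ord0, [tuple of behead t]).
have munc : measurable_fun setT uncons.
  by apply: measurable_fun_pair; [exact: measurable_tnth|exact: measurable_behead].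
have uncK : cancel (@cons_pair n) uncons.
  by case=> x t; congr (_, _); apply/val_inj.
exists (fun k => uncons @^-1` (F k `*` H k)).
  rewrite -preimage_bigcup (_ : \bigcup_k (F k `*` H k) = setT) ?preimage_setT//.
  apply/seteqP; split=> // -[x t] _.
  have [i _ Fix] : (\bigcup_k F k) x by rewrite -TF.
  have [j _ Hjt] : (\bigcup_k H k) t by rewrite -TH.
  exists (maxn i j) => //; split=> /=.
  - by move: x Fix; exact/subsetPset/ndF/leq_maxl.
  - by move: t Hjt; exact/subsetPset/ndH/leq_maxr.
move=> k; have [mF Fk] := Foo k; have [mH Hk] := Hoo k.
have mFH : measurable (F k `*` H k) by exact: measurableX.
split; first by rewrite -[X in measurable X]setTI; exact: munc.
rewrite /tuple_measureS /pushforward.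
rewrite (_ : _ @^-1` _ = F k `*` H k); last first.
  by apply/funext => p; rewrite /preimage/mkset -[p in RHS]uncK.
by rewrite product_measure1E// lte_mul_pinfty// ge0_fin_numE.
Qed.

HB.instance Definition _ := Measure_isSigmaFinite.Build _ _ _ tuple_measureS
  tuple_measureS_sigma_finite.

End succ.

Fixpoint tuple_measure n : {sigma_finite_measure set (n.-tuple T) -> \bar R} :=
  match n with
  | 0 => dirac [tuple]
  | m.+1 => tuple_measureS (tuple_measure m)
  end.

Lemma tuple_measure_box n (A : 'I_n -> set T) : (forall i, measurable (A i)) ->
  tuple_measure n [set t | forall i, A i (tnth t i)] = \prod_(i < n) mu (A i).
Proof.
elim: n A => [|n ih] A mA.
  rewrite big_ord0 /= diracE mem_set//=; by case.
rewrite big_ord_recl -ih//= /tuple_measureS /pushforward.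
rewrite -(product_measure1E mu (tuple_measure n))//.
- congr (_ _); apply/seteqP; split=> -[x t] /=.
  + move=> At; split=> [|i /=]; first exact: (At ord0).
    by have := At (lift ord0 i); rewrite tnth_cons_pairS.
  + move=> [Ax At] i; case: (unliftP ord0 i) => [j|] -> //.
    by rewrite tnth_cons_pairS; exact: At.
- rewrite (_ : [set _ | _] = \bigcap_(i in [set: 'I_n])
     ((fun t : n.-tuple T => tnth t i) @^-1` A (lift ord0 i))).
    apply: fin_bigcap_measurable => // i _.
    by rewrite -[X in measurable X]setTI; exact: measurable_tnth.
  by apply/seteqP; split=> t /= h i; [move=> _; exact: h|exact: (h i I)].
Qed.

End tuple_measure.

(* The type of vectors of R^d: the library's lebesgue_measure lives on the copy
   measurableTypeR R of R, whose measurable sets are those of R *)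
Notation Rpow R d := (d.-tuple (measurableTypeR R)).

Section gaussian.
Context (R : realType).
Local Notation gauss01 := (normal_prob (0 : R) 1).

Definition lebesgue_tuple d : {sigma_finite_measure set (Rpow R d) -> \bar R} :=
  tuple_measure (@lebesgue_measure R) d.

Definition std_gaussian N : {sigma_finite_measure set (Rpow R N) -> \bar R} :=
  tuple_measure gauss01 N.

Definition affine_map N (mu : 'I_N -> R) (A : 'M[R]_N) (z : Rpow R N) :
    Rpow R N :=
  [tuple mu i + \sum_(j < N) A i j * tnth z j | i < N].

(* The Gaussian law on R^N with mean mu and covariance matrix A *m A^T, which
   may be singular *)
Definition gaussian_law N (mu : 'I_N -> R) (A : 'M[R]_N) :
    set (Rpow R N) -> \bar R :=
  pushforward (std_gaussian N) (affine_map mu A).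

Definition gaussian_process d (Omega : measurableType d)
    (P : probability Omega R) (X : Type) (D : set X) (G : X -> Omega -> R)
    (m : X -> R) (k : X -> X -> R) : Prop :=
  forall (N : nat) (x : 'I_N -> X), (forall i, D (x i)) ->
  exists A : 'M[R]_N,
    A *m A^T = \matrix_(i, j) k (x i) (x j) /\
    forall B : set (Rpow R N), measurable B ->
      P [set w | B [tuple G (x i) w | i < N]] = gaussian_law (m \o x) A B.

Definition corr_factor (r : R) : 'M[R]_2 :=
  \matrix_(i, j) if i == ord0 then (j == ord0)%:R
                 else if j == ord0 then r else Num.sqrt (1 - r ^+ 2).

Lemma corr_factorE (r : R) : `|r| <= 1 ->
  corr_factor r *m (corr_factor r)^T = \matrix_(i, j) if i == j then 1 else r.
Proof.
move=> r1; have r2 : 0 <= 1 - r ^+ 2.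
  by rewrite subr_ge0 -real_normK ?num_real// expr_le1.
apply/matrixP => i j; rewrite !mxE big_ord_recl big_ord1 !mxE /=.
case: (unliftP ord0 i) => [i'|] ->; case: (unliftP ord0 j) => [j'|] -> /=.
- by rewrite (ord1 i') (ord1 j') eqxx -!expr2 sqr_sqrtr// addrC subrK.
- by rewrite mulr1 mulr0 addr0.
- by rewrite mul1r mul0r addr0.
- by rewrite mulr1 mul0r addr0.
Qed.

(* Cumulative distribution function of the centered Gaussian law on R^2 with
   covariance matrix ((1, r), (r, 1)); meaningful for |r| <= 1 only. *)
Definition Phi (r a b : R) : R :=
  fine (gaussian_law (fun=> 0) (corr_factor r)
    [set y : Rpow R 2 | tnth y ord0 <= a /\ tnth y ord_max <= b]).

End gaussian.

(* [kappa y] is the conditional law given Y = y, i.e. kappa is a regular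
   conditional probability *)
Definition conditional_law d d' (Omega : measurableType d)
    (E : measurableType d') (R : realType) (P : probability Omega R)
    (Y : Omega -> E) (kappa : E -> pprobability Omega R) : Prop :=
  measurable_fun setT kappa /\
  forall (A : set Omega) (B : set E), measurable A -> measurable B ->
    P (A `&` Y @^-1` B) = (\int[P]_(w in Y @^-1` B) kappa (Y w) A)%E.

Section criterion.
Context (R : realType) (X : Type) (m : X -> R) (k : X -> X -> R) (xnew : X).

Definition post_sd (x : X) : R := Num.sqrt (k x x).

Definition innovation (g : R) : R := (g - m xnew) / post_sd xnew ^+ 2.

Definition updated_mean (z : R) (x : X) : R := m x + k xnew x * z.

Definition order_stat l (i : nat) (v : 'I_l -> R) : R :=
  nth 0 (sort <=%R [seq v j | j <- enum 'I_l]) i.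

(* [order_stat] counts from 0, so this is the (floor (l * alpha) + 1)-th
   smallest value *)
Definition percentile_estimate l (alpha : R) (xMC : 'I_l -> X) (z : R) : R :=
  order_stat (Num.truncn (l%:R * alpha)) (updated_mean z \o xMC).

Definition line_crossing l (xMC : 'I_l -> X) (z : R) : Prop :=
  exists j j' : 'I_l, k (xMC j) xnew != k (xMC j') xnew /\
    updated_mean z (xMC j) = updated_mean z (xMC j').

Definition abscissa (L : nat) (I : nat -> R) (i : nat) : \bar R :=
  if i == 0%N then -oo%E else if (i <= L)%N then (I i)%:E else +oo%E.

Definition interval_B (L : nat) (I : nat -> R) (i : nat) : set R :=
  [set z | abscissa L I i <= z%:E <= abscissa L I i.+1]%E.

(* I 1 < ... < I L are the intersection abscissae left once neighbouring
   intervals with the same percentile point are merged, and xMC (jq i) is the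
   percentile point of the effective interval B_i, for 0 <= i <= L *)
Definition effective_intervals l (alpha : R) (xMC : 'I_l -> X)
    (L : nat) (I : nat -> R) (jq : nat -> 'I_l) : Prop :=
  [/\ forall i, (1 <= i < L)%N -> I i < I i.+1,
      forall i, (1 <= i <= L)%N -> line_crossing xMC (I i),
      forall i z, (i <= L)%N -> interval_B L I i z ->
        updated_mean z (xMC (jq i)) = percentile_estimate alpha xMC z &
      forall i, (i < L)%N -> xMC (jq i) <> xMC (jq i.+1)].

Definition var_W (xq x : X) : R :=
  post_sd x ^+ 2 + k xq xnew ^+ 2 / post_sd xnew ^+ 2
  - 2 * (k xq xnew * k x xnew / post_sd xnew ^+ 2).

(* sigma_W is the standard deviation of W = G(x) - m_{n+1}(xq) *)
Definition sigma_W (xq x : X) : R := Num.sqrt (var_W xq x).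

Definition e_n (xq x : X) : R := (m x - m xq) / sigma_W xq x.

Definition f_n (t : R) : R := t * post_sd xnew.

Definition r_n (xq x : X) : R :=
  (k xq xnew - k x xnew) / (Num.sqrt (var_W xq x) * post_sd xnew).

End criterion.

(* Gamma_{n+1} for the observed value g at xnew; kappa is the conditional law
   given the value of G at xnew *)
Definition Gamma (R : realType) d (dO : measure_display)
    (Omega : measurableType dO) (D : set (Rpow R d))
    (G : Rpow R d -> Omega -> R) (kappa : R -> pprobability Omega R)
    (q : R -> R) (g : R) : \bar R :=
  (\int[lebesgue_tuple R d]_(x in D) kappa g [set w | (q g <= G x w)%R])%E.

Definition J_prob (R : realType) d (dO : measure_display)
    (Omega : measurableType dO) (P : probability Omega R)
    (D : set (Rpow R d)) (G : Rpow R d -> Omega -> R)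
    (kappa : R -> pprobability Omega R) (q : R -> R) (xnew : Rpow R d)
    (alpha : R) : \bar R :=
  (`| \int[P]_w Gamma D G kappa q (G xnew w) - (1 - alpha)%:E |)%E.

(* Main.v *)
Require Import Defs.
From HB Require Import structures.
From mathcomp Require Import all_boot all_order all_algebra.
From mathcomp Require Import all_classical all_reals all_analysis.
From mathcomp Require Import measurable_realfun ring.
Import Order.TTheory GRing.Theory Num.Theory.
Import numFieldNormedType.Exports.
Local Open Scope classical_set_scope.
Local Open Scope ring_scope.

(* Exchanging the integrals over the domain and over G_{n+1} (Tonelli, with a
   regular conditional law) reduces the claim to the probability, for a fixed
   x, that G(x) >= q_{n+1}.  On each effective interval q_{n+1} is affine in z,
   so the event splits into pieces {Z in B_i, U_i <= e_i} with Z s_n(x_{n+1})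
   and U_i jointly Gaussian, standard and of correlation r_i.  Both are unit
   linear forms in a standard Gaussian vector of R^2, whose law is invariant
   under rotations and reflections, so that the probability of
   {U_i <= e, Z s_n(x_{n+1}) <= f} is Phi_{r_i}(e, f) even when |r_i| = 1.

   Rotation invariance is inherited from the Lebesgue measure of the plane,
   which is invariant under shears by Fubini and translation invariance;
   a rotation is a product of three shears. *)

(** * Rotation invariance of the standard Gaussian law of the plane *)

Section lebesgue_plane.
Context {R : realType}.
Local Notation mT := (measurableTypeR R).
Local Notation lam := (@lebesgue_measure R).
Local Notation gauss := (normal_prob (0 : R) 1).
Local Open Scope ereal_scope.

(** The Radon-Nikodym derivative of the normal law and [normal_pdf] have the same integral over
    every measurable set, hence agree almost everywhere. *)
Lemma ge0_integral_normal_prob (m s : R) (f : mT -> \bar R) :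
  measurable_fun [set: mT] f -> (forall x, 0 <= f x) ->
  \int[normal_prob m s]_x f x = \int[lam]_x (f x * (normal_pdf m s x)%:E).
Proof.
move=> mf f0; have dom := normal_prob_dominates m s.
rewrite -(Radon_Nikodym_SigmaFinite.change_of_variables dom)//.
have RNi := Radon_Nikodym_SigmaFinite.f_integrable dom.
have mp : measurable_fun [set: mT] (EFin \o normal_pdf m s : mT -> \bar R).
  by apply/measurable_EFinP; exact: measurable_normal_pdf.
apply: ae_eq_integral => //.
- by apply: emeasurable_funM => //; exact: measurable_int RNi.
- exact: emeasurable_funM.
- apply: ae_eqe_mul2l; apply: integral_ae_eq => //.
  by move=> E _ mE; rewrite -Radon_Nikodym_SigmaFinite.f_integral.
Qed.

(** The image of Lebesgue measure under a translation gives each half-open interval its length, and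
    this characterises Lebesgue measure. *)
Lemma ge0_integral_lebesgue_shift (a : R) (f : mT -> \bar R) :
  measurable_fun [set: mT] f -> (forall x, 0 <= f x) ->
  \int[lam]_x f (x + a)%R = \int[lam]_x f x.
Proof.
move=> mf f0.
have ma : measurable_fun [set: mT] ((fun x => x + a)%R : mT -> mT).
  exact: measurable_funD.
transitivity (\int[pushforward lam ((fun x => x + a)%R : mT -> mT)]_x f x).
  by rewrite ge0_integral_pushforward.
apply: eq_measure_integral => A mA _.
apply/esym/lebesgue_measure_unique => //= _ [[b c]] _ <-.
rewrite /pushforward.
rewrite (_ : _ @^-1` _ = `](b - a)%R, (c - a)%R]%classic); last first.
  by apply/seteqP; split => x /=; rewrite !in_itv/= ltrBlDr lerBrDr.
rewrite !lebesgue_measure_itv/= !lte_fin ltrD2r; case: ifPn => // _.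
by rewrite -!EFinB; congr (_%:E); ring.
Qed.

Lemma ge0_integral_lebesgueN (f : mT -> \bar R) :
  measurable_fun [set: mT] f -> (forall x, 0 <= f x) ->
  \int[lam]_x f (- x)%R = \int[lam]_x f x.
Proof.
move=> mf f0.
have ma : measurable_fun [set: mT] (-%R : mT -> mT) by exact: measurable_funN.
transitivity (\int[pushforward lam (-%R : mT -> mT)]_x f x).
  by rewrite ge0_integral_pushforward.
by apply: eq_measure_integral => A mA _; exact: lebesgue_measureN.
Qed.

Local Notation II F := (\int[lam]_x \int[lam]_y F (x, y)).

(** For a fixed second coordinate the shear is a translation of the first one; Tonelli makes the
    first coordinate the inner variable. *)
Lemma lebesgue2_shear1 (t : R) (F : mT * mT -> \bar R) :
  measurable_fun [set: mT * mT] F -> (forall z, 0 <= F z) ->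
  II (fun z => F (z.1 + t * z.2, z.2)%R) = II F.
Proof.
move=> mF F0.
have mS : measurable_fun [set: mT * mT]
    (fun z : mT * mT => F (z.1 + t * z.2, z.2)%R).
  apply: (measurableT_comp mF); apply: measurable_fun_pair => //=.
  by apply: measurable_funD => //; exact: measurable_funM.
transitivity (\int[lam]_y \int[lam]_x F (x + t * y, y)%R).
  exact: (fubini_tonelli (fun z : mT * mT => F (z.1 + t * z.2, z.2)%R)).
transitivity (\int[lam]_y \int[lam]_x F (x, y)); last first.
  by apply/esym; apply: fubini_tonelli.
apply: eq_integral => y _ /=.
apply: (ge0_integral_lebesgue_shift (t * y)%R (fun x => F (x, y))) => //.
by apply: measurableT_comp => //; exact: pair2_measurable.
Qed.

Lemma lebesgue2_shear2 (t : R) (F : mT * mT -> \bar R) :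
  measurable_fun [set: mT * mT] F -> (forall z, 0 <= F z) ->
  II (fun z => F (z.1, z.2 + t * z.1)%R) = II F.
Proof.
move=> mF F0; apply: eq_integral => x _ /=.
apply: (ge0_integral_lebesgue_shift (t * x)%R (fun y => F (x, y))) => //.
by apply: measurableT_comp => //; exact: pair1_measurable.
Qed.

Lemma lebesgue2_opp2 (F : mT * mT -> \bar R) :
  measurable_fun [set: mT * mT] F -> (forall z, 0 <= F z) ->
  II (fun z => F (z.1, - z.2)%R) = II F.
Proof.
move=> mF F0; apply: eq_integral => x _ /=.
apply: (ge0_integral_lebesgueN (fun y => F (x, y))) => //.
by apply: measurableT_comp => //; exact: pair1_measurable.
Qed.

Lemma lebesgue2_opp1 (F : mT * mT -> \bar R) :
  measurable_fun [set: mT * mT] F -> (forall z, 0 <= F z) ->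
  II (fun z => F (- z.1, z.2)%R) = II F.
Proof.
move=> mF F0.
transitivity (\int[lam]_y \int[lam]_x F (- x, y)%R).
  apply: (fubini_tonelli (fun z : mT * mT => F (- z.1, z.2)%R)) => //.
  by apply: (measurableT_comp mF); apply: measurable_fun_pair => //=;
    apply: measurableT_comp.
transitivity (\int[lam]_y \int[lam]_x F (x, y)); last first.
  by apply/esym; apply: fubini_tonelli.
apply: eq_integral => y _ /=.
apply: (ge0_integral_lebesgueN (fun x => F (x, y))) => //.
by apply: measurableT_comp => //; exact: pair2_measurable.
Qed.

Lemma lebesgue2_rotation (a b : R) (F : mT * mT -> \bar R) :
  (a ^+ 2 + b ^+ 2 = 1)%R ->
  measurable_fun [set: mT * mT] F -> (forall z, 0 <= F z) ->
  II (fun z => F (a * z.1 + b * z.2, - b * z.1 + a * z.2)%R) = II F.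
Proof.
move=> ab mF F0.
(* The factorization into shears divides by [b]. When [b = 0] the map is the identity or its
   opposite, the latter being a product of two sign changes. *)
have [b0|b0] := eqVneq b 0%R.
  have /eqP : (a ^+ 2 = 1)%R by rewrite -ab b0; ring.
  rewrite sqrf_eq1 b0 => /orP[|] /eqP ->.
    by apply: eq_integral => x _; apply: eq_integral => y _ /=;
      congr (F (_, _)); ring.
  pose F1 (z : mT * mT) := F (- z.1, z.2)%R.
  have mF1 : measurable_fun [set: mT * mT] F1.
    by apply: (measurableT_comp mF); apply: measurable_fun_pair => //=;
      apply: measurableT_comp.
  transitivity (II F1); last exact: (lebesgue2_opp1 F).
  transitivity (II (fun z => F1 (z.1, - z.2)%R)); last first.
    by apply: lebesgue2_opp2 => // z; exact: F0.
  by apply: eq_integral => x _; apply: eq_integral => y _; rewrite /F1/=;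
      congr (F (_, _)); ring.
(* For [a] and [b] the cosine and sine of an angle, [t] is the tangent of half of it. The shears of
   coefficients [t], [- b], [t], applied in turn, compose to the rotation. *)
pose t := ((1 - a) / b)%R.
have mS1 : measurable_fun [set: mT * mT]
    (fun z : mT * mT => (z.1 + t * z.2, z.2)%R).
  apply: measurable_fun_pair => //=.
  by apply: measurable_funD => //; exact: measurable_funM.
have mS2 : measurable_fun [set: mT * mT]
    (fun z : mT * mT => (z.1, z.2 + - b * z.1)%R).
  apply: measurable_fun_pair => //=.
  by apply: measurable_funD => //; exact: measurable_funM.
pose F2 (z : mT * mT) := F (z.1 + t * z.2, z.2)%R.
have mF2 : measurable_fun [set: mT * mT] F2 by exact: measurableT_comp.
pose F3 (z : mT * mT) := F2 (z.1, z.2 + - b * z.1)%R.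
have mF3 : measurable_fun [set: mT * mT] F3 by exact: measurableT_comp.
transitivity (II F2); last exact: (lebesgue2_shear1 t F).
transitivity (II F3); last first.
  by apply: (lebesgue2_shear2 _ F2) => // z; exact: F0.
transitivity (II (fun z => F3 (z.1 + t * z.2, z.2)%R)); last first.
  by apply: (lebesgue2_shear1 _ F3) => // z; exact: F0.
apply: eq_integral => x _; apply: eq_integral => y _; rewrite /F3 /F2/=.
have tb : (t * b = 1 - a)%R by rewrite /t divfK.
(* The other half-angle formula, which reduces the off-diagonal entry [t + t - t * b * t] to [b]. *)
have ta : (t * (1 + a) = b)%R.
  apply: (mulIf b0); rewrite mulrAC tb -expr2.
  by rewrite -[(b ^+ 2)%R](addKr (a ^+ 2)%R) ab; ring.
have tbt : (t * b * t = t - a * t)%R by rewrite tb; ring.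
congr (F (_, _)).
  transitivity ((1 - t * b) * x + (t + t - t * b * t) * y)%R; last by ring.
  by rewrite tbt tb -ta; ring.
transitivity (- b * x + (1 - t * b) * y)%R; last by ring.
by rewrite tb; ring.
Qed.

End lebesgue_plane.

Section gauss2.
Context {R : realType}.
Local Notation mT := (measurableTypeR R).
Local Notation lam := (@lebesgue_measure R).
Local Notation gauss := (normal_prob (0 : R) 1).
Local Notation II F := (\int[lam]_x \int[lam]_y F (x, y))%E.
Local Notation gauss2 := (gauss \x gauss)%E.

Let dens (z : mT * mT) : R := normal_pdf 0 1 z.1 * normal_pdf 0 1 z.2.

Let dens_ge0 z : 0 <= dens z.
Proof. by rewrite mulr_ge0// normal_pdf_ge0. Qed.

Let mdens : measurable_fun [set: mT * mT] dens.
Proof.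
by apply: measurable_funM;
  apply: (measurableT_comp (measurable_normal_pdf _ _)).
Qed.

Let gauss2_lebesgue (E : set (mT * mT)) : measurable E ->
  gauss2 E = II (fun z => (\1_E z * dens z)%R%:E).
Proof.
move=> mE; rewrite /product_measure1 ge0_integral_normal_prob//; last first.
  exact: measurable_fun_xsection.
apply: eq_integral => x _ /=.
rewrite {1}/normal_prob integral_mkcond -ge0_integralZr//=.
- apply: eq_integral => y _; rewrite epatch_indic /dens -!EFinM; congr (_%:E).
  by rewrite !indicE mem_xsection/=; ring.
- have mx := measurable_xsection x mE.
  apply/(measurable_restrictT _ mx).
  apply/measurable_funTS/measurable_EFinP; exact: measurable_normal_pdf.
- move=> y _; rewrite patchE; case: ifP => // _.
  by rewrite lee_fin normal_pdf_ge0.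
- by rewrite lee_fin normal_pdf_ge0.
Qed.

(** The density depends on [z] only through its squared norm, so the Gaussian law inherits the
    linear isometries that preserve Lebesgue measure. *)
Let densE (z : mT * mT) :
  dens z = normal_peak 1 ^+ 2 * expR (- (z.1 ^+ 2 + z.2 ^+ 2) / 2).
Proof.
rewrite /dens !normal_pdfE ?oner_neq0// /normal_fun !subr0 mulrACA -expr2.
by rewrite -expRD; congr (_ * expR _); rewrite expr1n; field.
Qed.

Lemma gauss2_rotation (a b : R) (E : set (mT * mT)) :
  a ^+ 2 + b ^+ 2 = 1 -> measurable E ->
  gauss2 [set z | E (a * z.1 + b * z.2, - b * z.1 + a * z.2)] = gauss2 E.
Proof.
move=> ab mE.
have mrot : measurable_fun [set: mT * mT]
    (fun z : mT * mT => (a * z.1 + b * z.2, - b * z.1 + a * z.2) : mT * mT).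
  by apply: measurable_fun_pair => //=;
    apply: measurable_funD; apply: measurable_funM.
have mrotE : measurable
    [set z : mT * mT | E (a * z.1 + b * z.2, - b * z.1 + a * z.2)].
  by rewrite -[X in measurable X]setTI; exact: mrot.
pose F (z : mT * mT) := (\1_E z * dens z)%:E.
have mF : measurable_fun [set: mT * mT] F.
  by apply/measurable_EFinP; apply: measurable_funM.
have F0 z : (0 <= F z)%E by rewrite lee_fin mulr_ge0.
have densr x y : dens (a * x + b * y, - b * x + a * y) = dens (x, y).
  rewrite [LHS]densE [RHS]densE /=.
  have -> : (a * x + b * y) ^+ 2 + (- b * x + a * y) ^+ 2 = x ^+ 2 + y ^+ 2.
    by rewrite -[RHS]mul1r -ab; ring.
  by [].
rewrite (gauss2_lebesgue _ mrotE) (gauss2_lebesgue _ mE).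
transitivity (II (fun z => F (a * z.1 + b * z.2, - b * z.1 + a * z.2)%R));
  last first.
  by apply: (lebesgue2_rotation a b F).
apply: eq_integral => x _; apply: eq_integral => y _; rewrite /F/=.
by rewrite densr !indicE.
Qed.

Lemma gauss2_reflection (E : set (mT * mT)) : measurable E ->
  gauss2 [set z | E (z.1, - z.2)] = gauss2 E.
Proof.
move=> mE.
have mrot : measurable_fun [set: mT * mT]
    (fun z : mT * mT => (z.1, - z.2) : mT * mT).
  by apply: measurable_fun_pair => //=; apply: measurableT_comp.
have mrotE : measurable [set z : mT * mT | E (z.1, - z.2)].
  by rewrite -[X in measurable X]setTI; exact: mrot.
pose F (z : mT * mT) := (\1_E z * dens z)%:E.
have mF : measurable_fun [set: mT * mT] F.
  by apply/measurable_EFinP; apply: measurable_funM.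
have F0 z : (0 <= F z)%E by rewrite lee_fin mulr_ge0.
have densr x y : dens (x, - y) = dens (x, y).
  by rewrite [LHS]densE [RHS]densE /= sqrrN.
rewrite (gauss2_lebesgue _ mrotE) (gauss2_lebesgue _ mE).
transitivity (II (fun z => F (z.1, - z.2)%R)); last first.
  by apply: (lebesgue2_opp2 F).
apply: eq_integral => x _; apply: eq_integral => y _; rewrite /F/=.
by rewrite densr !indicE.
Qed.

(** The recursive construction of the tuple measure ends with the Dirac mass at the empty tuple,
    which turns the innermost integral into the value of an indicator. *)
Lemma std_gaussian2E (B : set (Rpow R 2)) : measurable B ->
  std_gaussian R 2 B = gauss2 [set z | B [tuple z.1; z.2]].
Proof.
move=> mB.
rewrite /= /tuple_measureS /pushforward /product_measure1/=.
apply: eq_integral => x _ /=.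
rewrite /tuple_measureS /pushforward /product_measure1/=.
transitivity
  (\int[gauss]_y (\1_(xsection [set z | B [tuple z.1; z.2]] x) y)%:E)%E.
  apply: eq_integral => y _ /=.
  by rewrite diracE indicE !mem_xsection xsectionE.
rewrite integral_indic// ?setIT//.
apply: measurable_xsection.
rewrite -[X in measurable X]setTI.
apply: (_ : measurable_fun [set: mT * mT]
  (fun z : mT * mT => [tuple z.1; z.2] : Rpow R 2)) => //.
by do 2! apply: measurable_cons => //.
Qed.
End gauss2.

Lemma measurable_le_set {d} {T : measurableType d} {R : realType}
    (f g : T -> R) :
  measurable_fun [set: T] f -> measurable_fun [set: T] g ->
  measurable [set x | f x <= g x].
Proof.
move=> mf mg; rewrite -[X in measurable X]setTI.
have -> : [set x | f x <= g x] = (fun x => f x <= g x) @^-1` [set true] by [].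
exact: measurable_fun_ler.
Qed.

(** * Half planes under the standard Gaussian law of the plane *)

Section gaussian_pair.
Context {R : realType}.
Local Notation mT := (measurableTypeR R).
Local Notation gauss := (normal_prob (0 : R) 1).
Local Notation gauss2 := (gauss \x gauss)%E.

Lemma measurable_linear_le (u v c : R) :
  measurable [set z : mT * mT | u * z.1 + v * z.2 <= c].
Proof.
by apply: measurable_le_set => //; apply: measurable_funD;
  apply: measurable_funM.
Qed.

Lemma measurable_wedge (r c a b : R) :
  measurable [set z : mT * mT | z.1 <= a /\ r * z.1 + c * z.2 <= b].
Proof.
rewrite (_ : [set z | _] = [set z | 1 * z.1 + 0 * z.2 <= a] `&`
    [set z | r * z.1 + c * z.2 <= b]).
  by apply: measurableI; exact: measurable_linear_le.
by apply/seteqP; split => z /=; rewrite mul1r mul0r addr0.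
Qed.

Lemma measurable_affine_map N (mu : 'I_N -> R) (A : 'M[R]_N) :
  measurable_fun [set: Rpow R N] (@affine_map R N mu A).
Proof.
apply/measurable_fun_tnthP => i.
rewrite (_ : _ \o _ = fun z : Rpow R N =>
    mu i + \sum_(j < N) A i j * tnth z j); last first.
  by apply/funext => z /=; rewrite tnth_mktuple.
apply: measurable_funD => //; apply: measurable_sum => j.
by apply: measurable_funM => //; exact: measurable_tnth.
Qed.

Lemma gaussian_law2E (mu : 'I_2 -> R) (A : 'M[R]_2) (B : set (Rpow R 2)) :
  measurable B -> gaussian_law mu A B =
  gauss2 [set z | B [tuple mu ord0 + (A ord0 ord0 * z.1 + A ord0 ord_max * z.2);
          mu ord_max + (A ord_max ord0 * z.1 + A ord_max ord_max * z.2)]].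
Proof.
move=> mB; rewrite /gaussian_law /pushforward std_gaussian2E; last first.
  by rewrite -[X in measurable X]setTI; exact: measurable_affine_map.
congr (gauss2 _); apply/seteqP.
suff E z : affine_map mu A [tuple z.1; z.2] =
  [tuple mu ord0 + (A ord0 ord0 * z.1 + A ord0 ord_max * z.2);
          mu ord_max + (A ord_max ord0 * z.1 + A ord_max ord_max * z.2)].
  by split => z /=; rewrite /preimage/= E.
apply: eq_from_tnth => i; rewrite tnth_mktuple big_ord_recl big_ord1.
have [->|->] : i = ord0 \/ i = ord_max.
  by case: i => [[|[|//]]] h; [left|right]; apply/val_inj.
- rewrite !(tnth_nth 0)/=; congr (_ + (_ + A _ _ * _)); exact/val_inj.
- rewrite !(tnth_nth 0)/=; congr (_ + (_ + A _ _ * _)); exact/val_inj.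
Qed.

(** The two linear forms are the rows of [corr_factor r], the lower triangular factor of the
    correlation matrix. *)
Lemma Phi_gauss2 (r a b : R) : (Phi r a b)%:E =
  gauss2 [set z | z.1 <= a /\ r * z.1 + Num.sqrt (1 - r ^+ 2) * z.2 <= b].
Proof.
rewrite /Phi gaussian_law2E; last first.
  by apply: measurableI; apply: measurable_le_set => //; exact: measurable_tnth.
set S := [set z | _]; set S' := [set z | _].
have -> : S = S'.
  apply/seteqP; split => z; rewrite /S /S' /= !(tnth_nth 0)/= !mxE/=.
    by rewrite !add0r mul1r mul0r addr0.
  by rewrite !add0r mul1r mul0r addr0.
rewrite fineK//; apply: (fin_num_measure (gauss2 : probability _ R)).
exact: measurable_wedge.
Qed.

(* The rotation taking (p, q) to the first axis takes (u, v) to (r, t) with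
   r = p u + q v and t ^ 2 = 1 - r ^ 2; a reflection makes t nonnegative. *)
Lemma gauss2_half_planes (p q u v a b : R) :
  p ^+ 2 + q ^+ 2 = 1 -> u ^+ 2 + v ^+ 2 = 1 ->
  gauss2 [set z | p * z.1 + q * z.2 <= a /\ u * z.1 + v * z.2 <= b] =
  (Phi (p * u + q * v) a b)%:E.
Proof.
move=> pq uv; set r := p * u + q * v; pose t := p * v - q * u.
have uE : u = r * p - t * q by rewrite -[LHS]mul1r -pq /r /t; ring.
have vE : v = r * q + t * p by rewrite -[LHS]mul1r -pq /r /t; ring.
(* Lagrange's identity: [r ^+ 2 + t ^+ 2] is the product of the squared norms of [(p, q)] and
   [(u, v)]. *)
have t2 : t ^+ 2 = 1 - r ^+ 2.
  by rewrite -[1]mulr1 -{1}pq -uv /r /t; ring.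
transitivity (gauss2 [set z | z.1 <= a /\ r * z.1 + t * z.2 <= b]).
  rewrite -(gauss2_rotation p q _ pq (measurable_wedge _ _ _ _)).
  congr (gauss2 _).
  apply/seteqP; split => z /= [h1 h2]; split => //.
    by move: h2; rewrite uE vE; congr (_ <= _); ring.
  by move: h2; rewrite uE vE; congr (_ <= _); ring.
rewrite Phi_gauss2.
have [t0|t0] := leP 0 t.
  by rewrite -t2 sqrtr_sqr ger0_norm.
rewrite -(gauss2_reflection _ (measurable_wedge _ _ _ _)); congr (gauss2 _).
apply/seteqP; split => z /=;
  by rewrite -t2 sqrtr_sqr ltr0_norm// mulrN mulNr.
Qed.

(** A rotation makes the line vertical, and its measure is then the mass of a single point under the
    normal law. *)
Lemma gauss2_line0 (u v c : R) : u ^+ 2 + v ^+ 2 = 1 ->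
  gauss2 [set z | u * z.1 + v * z.2 = c] = 0%E.
Proof.
move=> uv.
have mc : measurable ([set c] : set mT) by exact: measurable_set1.
rewrite (_ : [set z | _] =
    [set z | ([set c] `*` [set: mT]) (u * z.1 + v * z.2, - v * z.1 + u * z.2)]).
  rewrite (gauss2_rotation u v _ uv); last exact: measurableX.
  have g0 : gauss [set c] = 0%E.
    have /null_content_dominatesP := @normal_prob_dominates R 0 1.
    by apply; [exact: mc|exact: lebesgue_measure_set1].
  transitivity (gauss [set c] * gauss [set: mT])%E.
    exact: product_measure1E.
  by rewrite g0 mul0e.
by apply/seteqP; split => z /=; [move=> ->|case].
Qed.
End gaussian_pair.

(** * Splitting the plane along the effective intervals *)

Section half_open_intervals.
Context {R : realType}.
Variables (L : nat) (c : nat -> R).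
Hypothesis c_incr : forall i, (1 <= i < L)%N -> c i < c i.+1.

(** The closed intervals [interval_B] share their endpoints; without the left endpoint they form a
    partition of the line. *)
Definition half_open (i : nat) (t : R) : bool :=
  ((abscissa L c i < t%:E) && (t%:E <= abscissa L c i.+1))%E.

Lemma breakpoints_le i j : (1 <= i <= j)%N -> (j <= L)%N -> c i <= c j.
Proof.
move=> /andP[i1]; elim: j => [|j IH]; first by rewrite leqn0 => /eqP ->.
rewrite leq_eqVlt => /orP[/eqP -> //|]; rewrite ltnS => ij jL.
rewrite (le_trans (IH ij (ltnW jL)))// ltW// c_incr//.
by rewrite (leq_trans i1 ij).
Qed.

(** If [i < j], then [t <= c i.+1 <= c j < t], a contradiction. *)
Lemma half_open_uniq i j t : (i <= L)%N -> (j <= L)%N ->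
  half_open i t -> half_open j t -> i = j.
Proof.
suff H i' j' : (i' < j')%N -> (j' <= L)%N ->
    half_open i' t -> half_open j' t -> False.
  move=> iL jL hi hj; have [ij|ij|//] := ltngtP i j.
    by case: (H _ _ ij jL hi hj).
  by case: (H _ _ ij iL hj hi).
move: i' j' => {}i {}j ij jL /andP[_ ti] /andP[tj _].
have := lt_le_trans tj ti; rewrite /abscissa/= (leq_trans ij jL) jL.
case: j ij jL {tj} => // j ij jL; rewrite lte_fin ltNge.
by rewrite breakpoints_le.
Qed.

(** The index is the least [i] whose right endpoint is at least [t]; minimality puts the left
    endpoint below [t]. The index [L], of right endpoint +oo, always qualifies. *)
Lemma half_open_exists t : exists2 i, (i <= L)%N & half_open i t.
Proof.
have ex : exists i, (t%:E <= abscissa L c i.+1)%E.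
  by exists L; rewrite /abscissa/= ltnn leey.
case: (ex_minnP ex) => i ti imin; exists i.
  by apply: imin; rewrite /abscissa/= ltnn leey.
rewrite /half_open ti andbT; case: i ti imin => [|i] ti imin.
  by rewrite /abscissa/= ltNyr.
by rewrite ltNge; apply/negP => /imin; rewrite ltnn.
Qed.

End half_open_intervals.

Section gaussian_partition.
Context {R : realType}.
Local Notation mT := (measurableTypeR R).
Local Notation gauss := (normal_prob (0 : R) 1).
Local Notation gauss2 := (gauss \x gauss)%E.

Let Q : probability _ R := gauss2.

Lemma measurable_linear_lt (u v c : R) :
  measurable [set z : mT * mT | c < u * z.1 + v * z.2].
Proof.
rewrite (_ : [set _ | _] = ~` [set z : mT * mT | u * z.1 + v * z.2 <= c]).
  by apply: measurableC; exact: measurable_linear_le.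
by apply/seteqP; split => z /=; rewrite ltNge => /negP.
Qed.

Let half_plane (p : R * R) (e : R) : set (mT * mT) :=
  [set z : mT * mT | p.1 * z.1 + p.2 * z.2 <= e].

Let mhp p e : measurable (half_plane p e).
Proof. exact: measurable_linear_le. Qed.

(** The region is a difference of two nested intersections of half planes, [H b] and [H a]. *)
Lemma gauss2_strip (p u : R * R) (e a b : R) : a <= b ->
  p.1 ^+ 2 + p.2 ^+ 2 = 1 -> u.1 ^+ 2 + u.2 ^+ 2 = 1 ->
  gauss2 [set z : mT * mT | a < u.1 * z.1 + u.2 * z.2 <= b /\
    p.1 * z.1 + p.2 * z.2 <= e] =
  (Phi (p.1 * u.1 + p.2 * u.2) e b - Phi (p.1 * u.1 + p.2 * u.2) e a)%:E.
Proof.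
move=> ab p1 u1.
pose H c := half_plane p e `&` half_plane u c.
have mH c : measurable (H c) by exact: measurableI.
have QH c : Q (H c) = (Phi (p.1 * u.1 + p.2 * u.2) e c)%:E.
  exact: gauss2_half_planes.
transitivity (Q (H b `\` H a)).
  congr (Q _); apply/seteqP; split => z /=.
    move=> [/andP[az zb] h]; split; first by split.
    by move=> [_]; rewrite /half_plane/= leNgt az.
  move=> [[h zb] /not_andP[//|/negP]]; rewrite /half_plane/= -ltNge => az.
  by rewrite az.
have Hab : H b `&` H a = H a.
  apply/seteqP; split => z; rewrite /H /half_plane/=; first by case.
  by move=> [h za]; split => //; split => //; rewrite (le_trans za).
rewrite measureD//; first by rewrite Hab EFinB; congr (_ - _)%E; exact: QH.
by rewrite ltey_eq fin_num_measure.
Qed.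

Lemma gauss2_above (p u : R * R) (e a : R) :
  p.1 ^+ 2 + p.2 ^+ 2 = 1 -> u.1 ^+ 2 + u.2 ^+ 2 = 1 ->
  gauss2 [set z : mT * mT | a < u.1 * z.1 + u.2 * z.2 /\
    p.1 * z.1 + p.2 * z.2 <= e] =
  (Phi (- (p.1 * u.1 + p.2 * u.2)) e (- a))%:E.
Proof.
move=> p1 u1; set S := [set z | _].
have mS : measurable S.
  by apply: measurableI; [exact: measurable_linear_lt|exact: mhp].
(* Phi (- r) e (- a) measures {u.z >= a}; the line {u.z = a} is negligible. *)
pose T := half_plane p e `&` [set z : mT * mT | u.1 * z.1 + u.2 * z.2 = a].
have mline : measurable [set z : mT * mT | u.1 * z.1 + u.2 * z.2 = a].
  rewrite (_ : [set _ | _] =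
      half_plane u a `&` half_plane (- u.1, - u.2) (- a)).
    exact: measurableI.
  apply/seteqP; split => z; rewrite /half_plane/= !mulNr -opprD lerN2.
    by move=> ->.
  by move=> [h1 h2]; apply/eqP; rewrite eq_le h1.
have mT0 : measurable T by exact: measurableI.
have T0 : Q T = 0%E.
  apply: (subset_measure0 mT0 mline); first by move=> z [].
  exact: gauss2_line0.
transitivity (Q S + Q T)%E; first by rewrite T0 adde0.
rewrite -(measureU Q)//; last first.
  by apply/seteqP; split => z //= [[az _] [_ /= E]]; rewrite E ltxx in az.
(* The half plane [u.z >= a] is [- u.z <= - a]: replacing [u] by its opposite negates the
   correlation. *)
have -> : - (p.1 * u.1 + p.2 * u.2) = p.1 * - u.1 + p.2 * - u.2 by ring.
transitivity (gauss2 [set z : mT * mT | p.1 * z.1 + p.2 * z.2 <= e /\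
    - u.1 * z.1 + - u.2 * z.2 <= - a]).
  congr (Q _); apply/seteqP; split => z /=; rewrite !mulNr -opprD lerN2.
    by move=> [[/ltW az h]|[h ->]].
  by move=> [h]; rewrite le_eqVlt => /orP[/eqP E|az]; [right|left].
by apply: gauss2_half_planes; rewrite ?sqrrN.
Qed.

(** The [L] breakpoints cut the line into [L.+1] pieces. The bounded ones are strips and make up the
    sum; the two unbounded ones, of indices 0 and [L], give the remaining terms. *)
Lemma gauss2_partition (L : nat) (c e : nat -> R) (p : nat -> R * R)
    (u : R * R) :
  (1 <= L)%N -> (forall i, (1 <= i < L)%N -> c i < c i.+1) ->
  (forall i, (i <= L)%N -> (p i).1 ^+ 2 + (p i).2 ^+ 2 = 1) ->
  u.1 ^+ 2 + u.2 ^+ 2 = 1 ->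
  let r i := (p i).1 * u.1 + (p i).2 * u.2 in
  gauss2 [set z : mT * mT | exists i, [/\ (i <= L)%N,
      half_open L c i (u.1 * z.1 + u.2 * z.2) &
      (p i).1 * z.1 + (p i).2 * z.2 <= e i]] =
  (\sum_(1 <= i < L) (Phi (r i) (e i) (c i.+1) - Phi (r i) (e i) (c i))
   + Phi (r 0%N) (e 0%N) (c 1%N) + Phi (- r L) (e L) (- c L))%:E.
Proof.
move=> L1 c_incr p1 u1 r.
pose A (i : nat) := [set z : mT * mT |
  half_open L c i (u.1 * z.1 + u.2 * z.2) /\
  (p i).1 * z.1 + (p i).2 * z.2 <= e i].
have hE0 t : half_open L c 0 t = (t <= c 1%N).
  by rewrite /half_open /abscissa L1/= ltNyr lee_fin.
have A0 : A 0%N = [set z : mT * mT |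
    (p 0%N).1 * z.1 + (p 0%N).2 * z.2 <= e 0%N /\
    u.1 * z.1 + u.2 * z.2 <= c 1%N].
  apply/seteqP; split => z /=; by rewrite /A/= hE0; case.
have AL : A L = [set z : mT * mT |
    c L < u.1 * z.1 + u.2 * z.2 /\
    (p L).1 * z.1 + (p L).2 * z.2 <= e L].
  have L0 : (L == 0%N) = false by case: (L) L1.
  by apply/seteqP; split => z /=; rewrite /A/= /half_open /abscissa/=;
    rewrite L0 leqnn ltnn leey andbT lte_fin.
have Ai i : (1 <= i < L)%N -> A i = [set z : mT * mT |
    c i < u.1 * z.1 + u.2 * z.2 <= c i.+1 /\
    (p i).1 * z.1 + (p i).2 * z.2 <= e i].
  move=> /andP[i1 iL]; have i0 : (i == 0%N) = false by case: (i) i1.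
  by apply/seteqP; split => z /=; rewrite /A/= /half_open /abscissa/=;
    rewrite i0 iL (ltnW iL) lte_fin lee_fin.
have mA i : (i <= L)%N -> measurable (A i).
  move=> iL.
  have mp : measurable [set z : mT * mT | (p i).1 * z.1 + (p i).2 * z.2 <= e i].
    exact: measurable_linear_le.
  have [->|i0] := eqVneq i 0%N.
    by rewrite A0; apply: measurableI; exact: measurable_linear_le.
  have [->|iL'] := eqVneq i L.
    rewrite AL; apply: measurableI; first exact: measurable_linear_lt.
    exact: measurable_linear_le.
  rewrite Ai; last by rewrite lt0n i0 ltn_neqAle iL' iL.
  rewrite (_ : [set _ | _] = [set z : mT * mT | c i < u.1 * z.1 + u.2 * z.2] `&`
      [set z | u.1 * z.1 + u.2 * z.2 <= c i.+1] `&`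
      [set z | (p i).1 * z.1 + (p i).2 * z.2 <= e i]).
    apply: measurableI => //.
    apply: measurableI; first exact: measurable_linear_lt.
    exact: measurable_linear_le.
  by apply/seteqP; split => z /=; [move=> [/andP[]]|move=> [[-> ->]]].
transitivity (Q (\big[setU/set0]_(i < L.+1) A i)).
  congr (gauss2 _); rewrite -bigcup_mkord; apply/seteqP; split => z /=.
    by move=> [i [iL h1 h2]]; exists i.
  by move=> [i /=]; rewrite ltnS => iL [h1 h2]; exists i.
have tA : trivIset `I_L.+1 A.
  apply/trivIsetP => i j iL jL ij; apply/seteqP; split => z // -[[hi _] [hj _]].
  move/eqP: ij; apply.
  by apply: (half_open_uniq L c c_incr i j _ _ _ hi hj); rewrite -ltnS.
have QA : Q (\big[setU/set0]_(i < L.+1) A i) = (\sum_(i < L.+1) Q (A i))%E.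
  have mA' k : (k < L.+1)%N -> measurable (A k) by rewrite ltnS; exact: mA.
  apply: measure_semi_additive_ord_I => //.
  apply: bigsetU_measurable => k _; exact: mA'.
rewrite QA -(big_mkord xpredT (fun i => Q (A i))) big_ltn// big_nat_recr//=.
have -> : Q (A 0%N) = (Phi (r 0%N) (e 0%N) (c 1%N))%:E.
  by rewrite A0; apply: gauss2_half_planes => //; apply: p1.
have -> : Q (A L) = (Phi (- r L) (e L) (- c L))%:E.
  by rewrite AL; apply: gauss2_above => //; apply: p1.
have -> : (\sum_(1 <= i < L) Q (A i) =
    (\sum_(1 <= i < L)
       (Phi (r i) (e i) (c i.+1) - Phi (r i) (e i) (c i)))%R%:E)%E.
  rewrite -sumEFin; apply: eq_big_nat => i /[dup] iL /andP[_ /ltnW iL'].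
  by rewrite Ai//; apply: gauss2_strip; rewrite ?p1// ltW// c_incr.
by rewrite addeA [X in (X + _)%E]addeC !EFinD.
Qed.
End gaussian_partition.

(** * Integration against a regular conditional law *)

Section conditioning.
Context {R : realType} {d dE dX : measure_display} {Omega : measurableType d}
  {E : measurableType dE} {X : measurableType dX}.
Variables (P : probability Omega R) (Y : Omega -> E)
  (kappa : E -> pprobability Omega R).
Hypothesis mY : measurable_fun [set: Omega] Y.
Hypothesis kappaP : conditional_law P Y kappa.
Local Open Scope ereal_scope.

Let mkappa : measurable_fun [set: E] kappa.
Proof. by case: kappaP. Qed.

Let mpair : measurable_fun [set: Omega] (fun w => (Y w, w)).
Proof. exact: measurable_fun_pair. Qed.

Lemma measurable_conditional_section (C : set (E * Omega)) :
  measurable C -> measurable_fun [set: E] (fun y => kappa y (xsection C y)).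
Proof.
move=> mC.
apply: (measurable_fun_xsection_finite_kernel (kprobability mkappa)).
by rewrite inE.
Qed.

(** On rectangles this is the definition of a conditional law; Dynkin's theorem extends it to the
    product sigma-algebra. *)
Lemma conditional_law_section (C : set (E * Omega)) : measurable C ->
  P [set w | C (Y w, w)] = \int[P]_w kappa (Y w) (xsection C (Y w)).
Proof.
have mS S : measurable S ->
    measurable_fun [set: Omega] (fun w => kappa (Y w) (xsection S (Y w))).
  by move=> mS; apply: (measurableT_comp (measurable_conditional_section _ mS)).
have mpre S : measurable S -> measurable [set w | S (Y w, w)].
  by move=> mS'; rewrite -[X in measurable X]setTI; exact: mpair.
pose G : set (set (E * Omega)) :=
  [set C | exists A, measurable A /\ exists B, measurable B /\ C = A `*` B].
move=> mC.
pose Pr (S : set (E * Omega)) :=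
  P [set w | S (Y w, w)] = \int[P]_w kappa (Y w) (xsection S (Y w)).
have mG : measurable = <<s G >>.
  rewrite measurable_prod_measurableType //; congr (<<s _ >>).
  rewrite predeqE; split => [[A mA [B mB <-]]|[A [mA [B [mB ->]]]]].
    by exists A; split => //; exists B.
  by exists A => //; exists B.
apply: (@dynkin_induction _ _ G Pr) => //; rewrite /Pr.
- move=> /= _ _ [X1 [mX1 [X2 [mX2 ->]]]] [Y1 [mY1 [Y2 [mY2 ->]]]].
  rewrite -setXI; exists (X1 `&` Y1); split; first exact: measurableI.
  by exists (X2 `&` Y2); split => //; exact: measurableI.
- rewrite (_ : [set _ | _] = setT)//.
  rewrite probability_setT.
  under eq_integral do rewrite xsectionE preimage_setT probability_setT.
  by rewrite integral_cst//= probability_setT mule1.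
- move=> _ [A [mA [B [mB ->]]]].
  rewrite (_ : [set _ | _] = B `&` Y @^-1` A); last first.
    by apply/seteqP; split => w /= [].
  case: kappaP => _ -> //.
  rewrite integral_mkcond; apply: eq_integral => w _; rewrite patchE.
  have [wA|wA] := boolP (w \in Y @^-1` A).
    by rewrite in_xsectionX//; move: wA; rewrite !inE.
  by rewrite notin_xsectionX ?measure0//; move: wA; rewrite !inE.
- move=> S mS' IH.
  rewrite (_ : [set w | _] = ~` [set w | S (Y w, w)])//.
  rewrite probability_setC; last exact: mpre.
  have kC w : kappa (Y w) (xsection (~` S) (Y w)) =
      1 - kappa (Y w) (xsection S (Y w)).
    rewrite -probability_setC; last exact: measurable_xsection.
    by congr (kappa (Y w) _); rewrite !xsectionE.
  under [RHS]eq_integral do rewrite kC.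
  have k1 w : kappa (Y w) (xsection S (Y w)) <= 1.
    by apply: probability_le1; exact: measurable_xsection.
  have mkC : measurable_fun [set: Omega]
      (fun w => 1 - kappa (Y w) (xsection S (Y w))).
    by apply: emeasurable_funB => //; exact: mS.
  (* The complement is handled by adding the two integrals, both nonnegative; subtracting afterwards
     is licit because the probability is finite. *)
  have H : \int[P]_w (1 - kappa (Y w) (xsection S (Y w))) +
      \int[P]_w kappa (Y w) (xsection S (Y w)) = 1.
    rewrite -ge0_integralD//; last 2 first.
    + move=> w _; rewrite sube_ge0// ?k1// fin_num_measure//.
      exact: measurable_xsection.
    + exact: mS.
    under eq_integral.
      move=> w _; rewrite subeK; last first.
        by apply: fin_num_measure; exact: measurable_xsection.
      over.
    by rewrite integral_cst//= probability_setT mule1.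
  rewrite IH -[X in X - _]H addeK// -IH.
  by apply: fin_num_measure; exact: mpre.
- move=> F mF tF IH.
  rewrite (_ : [set w | _] = \bigcup_k [set w | F k (Y w, w)])//.
  rewrite measure_semi_bigcup//; last 3 first.
  + by move=> k; exact: mpre.
  + apply/trivIsetP => i j _ _ ij; apply/seteqP; split => w //= [h1 h2].
    by have /trivIsetP/(_ i j I I ij)/seteqP[/(_ (Y w, w)) + _] := tF; apply.
  + by apply: bigcup_measurable => k _; exact: mpre.
  rewrite (eq_eseriesr (fun k _ => IH k)) -integral_nneseries//; last first.
    by move=> k; exact: mS.
  apply: eq_integral => w _.
  rewrite xsection_bigcup measure_semi_bigcup//.
  + by move=> k; exact: measurable_xsection.
  + exact: trivIset_xsection.
  + by apply: bigcup_measurable => k _; exact: measurable_xsection.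
- by rewrite -mG.
Qed.

End conditioning.

Section conditional_fubini.
Context {R : realType} {d dE dX : measure_display} {Omega : measurableType d}
  {E : measurableType dE} {X : measurableType dX}.
Variables (P : probability Omega R) (Y : Omega -> E)
  (kappa : E -> pprobability Omega R)
  (mu : {sigma_finite_measure set X -> \bar R}).
Hypothesis mY : measurable_fun [set: Omega] Y.
Hypothesis kappaP : conditional_law P Y kappa.
Local Open Scope ereal_scope.

(** Tonelli exchanges the two integrals, after which [conditional_law_section] applies for each
    fixed [x]. *)
Lemma integral_conditional_law (C : set (E * X * Omega)) : measurable C ->
  \int[P]_w \int[mu]_x kappa (Y w) (xsection C (Y w, x)) =
  \int[mu]_x P [set w | C ((Y w, x), w)].
Proof.
move=> mC; have [mkappa _] := kappaP.
(* Regarded as a kernel from [E * X] that ignores the second variable, [kappa] has sections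
   measurable in both variables jointly. *)
have mk2 : measurable_fun [set: E * X] (kappa \o fst).
  exact: measurableT_comp.
have mf : measurable_fun [set: Omega * X]
    (fun p => kappa (Y p.1) (xsection C (Y p.1, p.2))).
  have mC' : C \in measurable by rewrite inE.
  have := measurable_fun_xsection_finite_kernel (kprobability mk2) mC'.
  move=> /measurableT_comp; apply.
  by apply: measurable_fun_pair => //; exact: measurableT_comp.
transitivity (\int[mu]_x \int[P]_w kappa (Y w) (xsection C (Y w, x))).
  exact: (fubini_tonelli
    (fun p : Omega * X => kappa (Y p.1) (xsection C (Y p.1, p.2)))).
apply: eq_integral => x _.
have mCx : measurable [set p : E * Omega | C ((p.1, x), p.2)].
  rewrite -[X in measurable X]setTI.
  apply: (_ : measurable_fun setT (fun p : E * Omega => ((p.1, x), p.2))) => //.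
  apply: measurable_fun_pair => //.
  exact: measurable_fun_pair.
rewrite (conditional_law_section P Y kappa mY kappaP _ mCx).
by apply: eq_integral => w _; rewrite !xsectionE.
Qed.
End conditional_fubini.

(** * Almost everywhere equality and monotonicity *)

Section nonmeasurable_ae_integral.
Context {R : realType} {d : measure_display} {T : measurableType d}.
Variable mu : {measure set T -> \bar R}.
Local Open Scope ereal_scope.

Import HBNNSimple.

(** The integral of a nonnegative function is a supremum over the simple functions below it, and a
    larger function has more of them. *)
Let ge0_le_integral_nonmeasurable (f g : T -> \bar R) :
  (forall x, 0 <= f x) -> (forall x, f x <= g x) ->
  \int[mu]_x f x <= \int[mu]_x g x.
Proof.
move=> f0 fg; rewrite !ge0_integralTE//; last first.
  by move=> x; exact: le_trans (fg x).
apply: ereal_sup_le => _ [h /= hf <-].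
by exists h => //= x; exact: le_trans (fg x).
Qed.

(* Needed because the integrand made of the Phi's is not known to be
   measurable: the library's ge0_ae_eq_integral asks it of both functions. *)
Lemma ge0_ae_eq_integral_nonmeasurable (f g : T -> \bar R) :
  measurable_fun [set: T] f -> (forall x, 0 <= f x) -> (forall x, 0 <= g x) ->
  {ae mu, forall x, f x = g x} -> \int[mu]_x f x = \int[mu]_x g x.
Proof.
move=> mf f0 g0 [N [mN N0 fgN]].
have fg x : x \notin N -> f x = g x.
  move=> /negP xN; apply: contrapT => fgx; apply: xN; apply/mem_set.
  exact: fgN.
(* [lo] and [hi] are measurable, enclose [g], and differ from [f] only on the null set [N]. *)
pose lo x := if x \in N then 0 else f x.
pose hi x := if x \in N then +oo else f x.
have mbN : measurable_fun [set: T] (fun x => x \in N).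
  apply: (measurable_fun_bool true); rewrite setTI.
  rewrite (_ : _ @^-1` _ = N)//.
  by apply/seteqP; split => x /= => [/set_mem|/mem_set].
have aeN (h : T -> \bar R) :
    (forall x, x \notin N -> f x = h x) -> ae_eq mu setT f h.
  move=> fh; exists N; split => // x /= nfh.
  apply: contrapT => xN; apply: nfh => _.
  by apply: fh; apply/negP => /set_mem.
apply/eqP; rewrite eq_le; apply/andP; split.
- rewrite (_ : \int[mu]_x f x = \int[mu]_x lo x).
    apply: ge0_le_integral_nonmeasurable => x; rewrite /lo; case: ifPn => //.
    by move=> /fg ->.
  apply: ge0_ae_eq_integral => //.
  + exact: measurable_fun_ifT.
  + by move=> x _; rewrite /lo; case: ifP.
  + by apply: aeN => x xN; rewrite /lo (negbTE xN).
- rewrite (_ : \int[mu]_x f x = \int[mu]_x hi x).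
    apply: ge0_le_integral_nonmeasurable => // x; rewrite /hi; case: ifPn => //.
      by rewrite leey.
    by move=> /fg ->.
  apply: ge0_ae_eq_integral => //.
  + exact: measurable_fun_ifT.
  + by move=> x _; rewrite /hi; case: ifP.
  + by apply: aeN => x xN; rewrite /hi (negbTE xN).
Qed.

End nonmeasurable_ae_integral.

Section Phi_monotone.
Context {R : realType}.

Lemma Phi_ge0 (r a b : R) : 0 <= Phi r a b.
Proof. by rewrite -lee_fin Phi_gauss2; exact: measure_ge0. Qed.

(** Makes each difference in the final sum nonnegative. *)
Lemma Phi_le (r a b b' : R) : b <= b' -> Phi r a b <= Phi r a b'.
Proof.
move=> bb'; pose Q : probability _ R := (normal_prob 0 1 \x normal_prob 0 1)%E.
pose S c := [set z : measurableTypeR R * measurableTypeR R |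
  z.1 <= a /\ r * z.1 + Num.sqrt (1 - r ^+ 2) * z.2 <= c].
have QS c : (Phi r a c)%:E = Q (S c) by exact: Phi_gauss2.
have mS c : S c \in measurable by apply/mem_set; exact: measurable_wedge.
have sS : S b `<=` S b' by move=> z [h1 h2]; split => //; exact: le_trans bb'.
have : (Q (S b) <= Q (S b'))%E := le_measure Q (mS b) (mS b') sS.
by rewrite -(QS b) -(QS b') lee_fin.
Qed.

End Phi_monotone.

(** * The percentile estimate *)

Section percentile.
Context {R : realType} {X : Type}.
Variables (m : X -> R) (k : X -> X -> R) (xnew : X) (l : nat) (alpha : R).
Variables (xMC : 'I_l -> X) (L : nat) (I : nat -> R) (jq : nat -> 'I_l).
Hypothesis effI : effective_intervals m k xnew alpha xMC L I jq.

Lemma percentile_half_open i t : (i <= L)%N -> half_open L I i t ->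
  percentile_estimate m k xnew alpha xMC t =
  updated_mean m k xnew t (xMC (jq i)).
Proof.
move=> iL /andP[h1 h2]; case: effI => _ _ H _; apply/esym/(H i) => //.
by rewrite /interval_B/= h2 ltW.
Qed.

Lemma measurable_half_open i : measurable_fun [set: R] (half_open L I i).
Proof.
apply: measurable_and.
  rewrite /abscissa; case: ifPn => _.
    by under eq_fun do rewrite ltNyr; exact: measurable_cst.
  case: ifPn => _.
    by under eq_fun do rewrite lte_fin; exact: measurable_fun_ltr.
  by under eq_fun do rewrite ltNge leey; exact: measurable_cst.
rewrite /abscissa/=; case: ifP => _.
  by under eq_fun do rewrite lee_fin; exact: measurable_fun_ler.
by under eq_fun do rewrite leey; exact: measurable_cst.
Qed.

(** Measurability is read off the effective intervals: the order statistic is a finite sum of affine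
    functions cut off to disjoint intervals. *)
Lemma measurable_percentile :
  measurable_fun [set: R] (percentile_estimate m k xnew alpha xMC).
Proof.
have [Iincr _ _ _] := effI.
have -> : percentile_estimate m k xnew alpha xMC = fun t =>
    \sum_(i < L.+1) (if half_open L I i t
                     then updated_mean m k xnew t (xMC (jq i)) else 0).
  apply/funext => t; have [i iL hi] := half_open_exists L I t.
  rewrite (bigD1 (Ordinal (iL : (i < L.+1)%N)))//= hi big1 ?addr0; last first.
    move=> j ji; case: ifP => // hj; move/eqP: ji; case; apply/val_inj => /=.
    by apply: (half_open_uniq L I Iincr _ _ _ _ _ hj hi); rewrite // -ltnS.
  exact: percentile_half_open.
apply: measurable_sum => i; apply: measurable_fun_ifT => //.
  exact: measurable_half_open.
apply: measurable_funD => //; exact: measurable_funM.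
Qed.

End percentile.

(** Used to pass from [z] to the standard variable [z * s], with breakpoints multiplied by [s]
    accordingly. *)
Lemma half_open_scale {R : realType} (L : nat) (I : nat -> R) (s t : R) i :
  0 < s -> half_open L (fun i => I i * s) i (t * s) = half_open L I i t.
Proof.
move=> s0; rewrite /half_open /abscissa; congr (_ && _).
  case: ifP => _; first by rewrite !ltNyr.
  by case: ifP => _; rewrite ?lte_fin ?ltr_pM2r// !ltNge !leey.
case: ifP => _; first by rewrite !lee_fin ler_pM2r.
by rewrite !leey.
Qed.

(** * The probability of exceeding the percentile estimate at a fixed point *)

Section exceedance.
Context {R : realType} {d : measure_display} {Omega : measurableType d}
  {X : Type}.
Variables (P : probability Omega R) (D : set X) (G : X -> Omega -> R)
  (m : X -> R) (k : X -> X -> R).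
Hypothesis GP : gaussian_process P D G m k.

(** The vectors [a] and [b] are the rows of the covariance factor supplied by [gaussian_process], so
    that variances and covariance become inner products in the plane. *)
Lemma gaussian_process_pair (x y : X) : D x -> D y ->
  exists a b : R * R, [/\ k x x = a.1 ^+ 2 + a.2 ^+ 2,
    k y y = b.1 ^+ 2 + b.2 ^+ 2, k x y = a.1 * b.1 + a.2 * b.2 &
    forall B : set (R * R), measurable B ->
      P [set w | B (G x w, G y w)] =
      (normal_prob 0 1 \x normal_prob 0 1)%E
        [set z | B (m x + (a.1 * z.1 + a.2 * z.2),
                    m y + (b.1 * z.1 + b.2 * z.2))]].
Proof.
move=> Dx Dy; pose xs (i : 'I_2) := if i == ord0 then x else y.
have Dxs i : D (xs i) by rewrite /xs; case: ifP.
have [A [AK law]] := GP _ xs Dxs.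
have KE i j : k (xs i) (xs j) = A i ord0 * A j ord0 + A i ord_max * A j ord_max.
  have /matrixP/(_ i j) := AK.
  rewrite !mxE big_ord_recl big_ord1 !mxE => <-.
  by rewrite (_ : lift ord0 ord0 = ord_max)//; exact/val_inj.
exists (A ord0 ord0, A ord0 ord_max), (A ord_max ord0, A ord_max ord_max).
split => /=.
- by rewrite -[x]/(xs ord0) KE !expr2.
- by rewrite -[y]/(xs ord_max) KE !expr2.
- by rewrite -[x]/(xs ord0) -[y]/(xs ord_max) KE.
move=> B mB.
pose B2 : set (Rpow R 2) := [set t | B (tnth t ord0, tnth t ord_max)].
have mB2 : measurable B2.
  rewrite -[X in measurable X]setTI.
  apply: (_ : measurable_fun setT (fun t : Rpow R 2 =>
    (tnth t ord0, tnth t ord_max)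
      : measurableTypeR R * measurableTypeR R)) => //.
  by apply: measurable_fun_pair; exact: measurable_tnth.
have := law _ mB2; rewrite gaussian_law2E// => E.
transitivity (P [set w | B2 [tuple G (xs i) w | i < 2]]).
  by congr (P _); apply/seteqP; split => w; rewrite /B2/= !tnth_mktuple.
by rewrite E.
Qed.

Hypothesis k_sym : forall x y, D x -> D y -> k x y = k y x.
Variables (xnew : X) (l : nat) (alpha : R) (xMC : 'I_l -> X).
Variables (L : nat) (I : nat -> R) (jq : nat -> 'I_l).
Hypothesis Dnew : D xnew.
Hypothesis snew : 0 < post_sd k xnew.
Hypothesis DMC : forall j, D (xMC j).
Hypothesis L1 : (1 <= L)%N.
Hypothesis effI : effective_intervals m k xnew alpha xMC L I jq.

(** With both values of the process affine in a standard Gaussian vector, the event restricted to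
    one effective interval is a half plane, and [gauss2_partition] adds up the pieces. *)
Lemma percentile_exceedance (x : X) : D x ->
  (forall i, (i <= L)%N -> 0 < var_W k xnew (xMC (jq i)) x) ->
  let e i := e_n m k xnew (xMC (jq i)) x in
  let r i := r_n k xnew (xMC (jq i)) x in
  let f := f_n k xnew in
  P [set w | percentile_estimate m k xnew alpha xMC
      (innovation m k xnew (G xnew w)) <= G x w] =
  (\sum_(1 <= i < L)
      (Phi (r i) (e i) (f (I i.+1)) - Phi (r i) (e i) (f (I i)))
    + Phi (r 0%N) (e 0%N) (f (I 1%N))
    + Phi (- r L) (e L) (- f (I L)))%:E.
Proof.
move=> Dx varW e r f.
have [a [b [kxx kss kxs law]]] := gaussian_process_pair _ _ Dx Dnew.
pose s := post_sd k xnew; have s_neq0 : s != 0 by rewrite gt_eqF.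
have s2 : s ^+ 2 = b.1 ^+ 2 + b.2 ^+ 2.
  by rewrite sqr_sqrtr// kss addr_ge0// sqr_ge0.
have sx2 : post_sd k x ^+ 2 = a.1 ^+ 2 + a.2 ^+ 2.
  by rewrite sqr_sqrtr// kxx addr_ge0// sqr_ge0.
have [Iincr _ _ _] := effI.
pose kq i := k (xMC (jq i)) xnew.
pose sig i := sigma_W k xnew (xMC (jq i)) x.
have sig_gt0 i : (i <= L)%N -> 0 < sig i by move=> iL; rewrite sqrtr_gt0 varW.
have sig2 i : (i <= L)%N ->
    sig i ^+ 2 = a.1 ^+ 2 + a.2 ^+ 2 + kq i ^+ 2 / s ^+ 2
    - 2 * (kq i * (a.1 * b.1 + a.2 * b.2) / s ^+ 2).
  by move=> iL; rewrite sqr_sqrtr ?(ltW (varW _ iL))// /var_W sx2 kxs.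
(* U_i = - (G x - m_{n+1}(xq_i) - E[...]) / sigma_W is the linear form p i. *)
pose p i := ((kq i * b.1 / s ^+ 2 - a.1) / sig i,
             (kq i * b.2 / s ^+ 2 - a.2) / sig i).
(* The innovation is [b.z / s ^+ 2], so [u.z] is the innovation times [s]. *)
pose u := (b.1 / s, b.2 / s).
pose q y := percentile_estimate m k xnew alpha xMC (innovation m k xnew y).
have mq : measurable_fun [set: R] q.
  apply: (measurableT_comp
    (measurable_percentile m k xnew l alpha xMC L I jq effI)).
  by apply: measurable_funM => //; apply: measurable_funB.
have u1 : u.1 ^+ 2 + u.2 ^+ 2 = 1.
  by rewrite /u/= !expr_div_n -mulrDl -s2 divff//; exact: expf_neq0.
(* [sig i] is the norm of the vector [kq i * b / s ^+ 2 - a]: expand the square and use that [b] has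
   squared norm [s ^+ 2]. *)
have p1 i : (i <= L)%N -> (p i).1 ^+ 2 + (p i).2 ^+ 2 = 1.
  move=> iL; have sg0 : sig i != 0 by rewrite gt_eqF// sig_gt0.
  rewrite /p/= !expr_div_n -mulrDl.
  rewrite [X in X / _ = _](_ : _ = sig i ^+ 2) ?divff ?expf_neq0//.
  rewrite sig2//.
  transitivity (a.1 ^+ 2 + a.2 ^+ 2
    + kq i ^+ 2 * (b.1 ^+ 2 + b.2 ^+ 2) / (s ^+ 2) ^+ 2
    - 2 * (kq i * (a.1 * b.1 + a.2 * b.2) / s ^+ 2)).
    by field.
  by rewrite -s2; field.
have rE i : (i <= L)%N -> r i = (p i).1 * u.1 + (p i).2 * u.2.
  move=> iL; have sg0 : sig i != 0 by rewrite gt_eqF// sig_gt0.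
  transitivity ((kq i * (b.1 ^+ 2 + b.2 ^+ 2) / s ^+ 2
    - (a.1 * b.1 + a.2 * b.2)) / (sig i * s)).
    rewrite -s2 mulfK ?expf_neq0//.
    by rewrite /r /r_n -/(kq i) kxs.
  by rewrite /p /u/=; field; rewrite s_neq0 sg0.
transitivity ((normal_prob 0 1 \x normal_prob 0 1)%E
   [set z : measurableTypeR R * measurableTypeR R | exists i, [/\ (i <= L)%N,
      half_open L (fun i => I i * s) i (u.1 * z.1 + u.2 * z.2) &
      (p i).1 * z.1 + (p i).2 * z.2 <= e i]]).
  have mB : measurable [set t : R * R | q t.2 <= t.1].
    by apply: measurable_le_set => //; exact: measurableT_comp.
  transitivity
    (P [set w | [set t : R * R | q t.2 <= t.1] (G x w, G xnew w)]) => //.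
  rewrite (law _ mB); congr (_ _).
  pose y (z : measurableTypeR R * measurableTypeR R) : R :=
    m xnew + (b.1 * z.1 + b.2 * z.2).
  (* On piece [i] the percentile estimate is the line of [xMC (jq i)]; multiplying the half-plane
     inequality by [sig i > 0] gives back the comparison with [G x]. Symmetry of [k] is used because
     [updated_mean] takes the candidate point as first argument and [kq] as second. *)
  have zE z i : (i <= L)%N -> half_open L I i (innovation m k xnew (y z)) ->
      (q (y z) <= m x + (a.1 * z.1 + a.2 * z.2)) =
      ((p i).1 * z.1 + (p i).2 * z.2 <= e i).
    move=> iL hi; have sg := sig_gt0 _ iL.
    have sg0 : sig i != 0 by rewrite gt_eqF.
    rewrite /q (percentile_half_open _ _ _ _ _ _ _ _ _ effI _ _ iL hi).
    rewrite /e /e_n -/(sig i) /updated_mean k_sym// -/(kq i) ler_pdivlMr//.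
    rewrite (_ : ((p i).1 * z.1 + (p i).2 * z.2) * sig i =
      kq i * innovation m k xnew (y z) - (a.1 * z.1 + a.2 * z.2)).
      by rewrite lerBrDr addrAC lerBlDr addrC.
    by rewrite /p/= /innovation /y -/s; field; rewrite sg0 s_neq0.
  have hE z i : half_open L (fun i => I i * s) i (u.1 * z.1 + u.2 * z.2) =
      half_open L I i (innovation m k xnew (y z)).
    rewrite -(half_open_scale L I s _ i snew); congr (half_open _ _ _ _).
    by rewrite /u/= /innovation /y -/s; field.
  apply/seteqP; split => z /=.
    have [i iL hi] := half_open_exists L I (innovation m k xnew (y z)).
    by rewrite (zE _ i)// => h; exists i; rewrite hE.
  by move=> [i [iL]]; rewrite hE => hi; rewrite (zE _ i).
pose r' i := (p i).1 * u.1 + (p i).2 * u.2.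
transitivity (\sum_(1 <= i < L)
       (Phi (r' i) (e i) (I i.+1 * s) - Phi (r' i) (e i) (I i * s))
   + Phi (r' 0%N) (e 0%N) (I 1%N * s) + Phi (- r' L) (e L) (- (I L * s)))%:E.
  apply: (gauss2_partition L (fun i => I i * s) e p u) => //.
  by move=> i iL; rewrite ltr_pM2r// Iincr.
have sumE :
    \sum_(1 <= i < L)
       (Phi (r i) (e i) (f (I i.+1)) - Phi (r i) (e i) (f (I i))) =
    \sum_(1 <= i < L)
       (Phi (r' i) (e i) (I i.+1 * s) - Phi (r' i) (e i) (I i * s)).
  by apply: eq_big_nat => i /andP[_ /ltnW iL]; rewrite (rE i iL).
by rewrite [in RHS]sumE [in RHS](rE 0%N (leq0n L)) [in RHS](rE L (leqnn L)).
Qed.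

End exceedance.

(** * The criterion: exchange of integrals and evaluation of the integrand *)

Theorem proposition3p2
  (R : realType)
  (* the input domain and the process *)
  (d : nat) (D : set (Rpow R d)) (mD : measurable D)
  (dO : measure_display) (Omega : measurableType dO) (P : probability Omega R)
  (G : Rpow R d -> Omega -> R)
  (mG : measurable_fun (D `*` [set: Omega]) (fun p => G p.1 p.2))
  (m0 : Rpow R d -> R) (k0 : Rpow R d -> Rpow R d -> R)
  (GP0 : gaussian_process P D G m0 k0)
  (* conditioning on the observations (x_i, g x_i), i < n *)
  (n : nat) (xobs : 'I_n -> Rpow R d) (Dobs : forall i, D (xobs i))
  (g : Rpow R d -> R)
  (kappa : Rpow R n -> pprobability Omega R)
  (kappaP : conditional_law P (fun w => [tuple G (xobs i) w | i < n]) kappa)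
  (Pn : probability Omega R) (PnE : Pn = kappa [tuple g (xobs i) | i < n])
  (mn : Rpow R d -> R) (kn : Rpow R d -> Rpow R d -> R)
  (mnE : forall x, D x -> 'E_Pn[G x]%E = (mn x)%:E)
  (knE : forall x y, D x -> D y -> covariance Pn (G x) (G y) = (kn x y)%:E)
  (GPn : gaussian_process Pn D G mn kn)
  (* the candidate point, and conditioning on the value of G there *)
  (xnew : Rpow R d) (Dnew : D xnew) (snew : 0 < post_sd kn xnew)
  (kappa' : R -> pprobability Omega R)
  (kappa'P : conditional_law Pn (G xnew) kappa')
  (* the sample, the level and the effective intervals *)
  (alpha : R) (alpha01 : 0 < alpha < 1)
  (l : nat) (xMC : 'I_l -> Rpow R d) (DMC : forall j, D (xMC j))
  (L : nat) (I : nat -> R) (jq : nat -> 'I_l) (L1 : (1 <= L)%N)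
  (effI : effective_intervals mn kn xnew alpha xMC L I jq)
  (* nondegeneracy, without which e_n and r_n are undefined *)
  (varW : {ae lebesgue_tuple R d, forall x, D x ->
     forall i, (i <= L)%N -> 0 < var_W kn xnew (xMC (jq i)) x}) :
  let q := fun y : R => percentile_estimate mn kn xnew alpha xMC
                          (innovation mn kn xnew y) in
  let e := fun i x => e_n mn kn xnew (xMC (jq i)) x in
  let r := fun i x => r_n kn xnew (xMC (jq i)) x in
  let f := fun t => f_n kn xnew t in
  J_prob Pn D G kappa' q xnew alpha =
  `| \int[lebesgue_tuple R d]_(x in D)
       (\sum_(1 <= i < L)
          (Phi (r i x) (e i x) (f (I i.+1)) - Phi (r i x) (e i x) (f (I i)))
        + Phi (r 0%N x) (e 0%N x) (f (I 1%N))
        + Phi (- r L x) (e L x) (- f (I L)))%R%:E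
     - (1 - alpha)%:E |%E.
Proof.
move=> q e r f.
have k_sym x y : D x -> D y -> kn x y = kn y x.
  by move=> Dx Dy; apply: EFin_inj; rewrite -!knE// covarianceC.
have [Iincr _ _ _] := effI.
have mGx : measurable_fun [set: Omega] (G xnew).
  move=> _ B mB; rewrite setTI.
  have mDT : measurable (D `*` [set: Omega]) by exact: measurableX.
  (* As [xnew] lies in [D], the section at [xnew] loses nothing of [Omega]. *)
  have /(measurable_xsection xnew) := mG mDT B mB.
  rewrite xsectionE (_ : _ @^-1` _ = G xnew @^-1` B)//.
  by apply/seteqP; split => w //= [].
have mq : measurable_fun [set: R] q.
  apply: (measurableT_comp
    (measurable_percentile mn kn xnew l alpha xMC L I jq effI)).
  by apply: measurable_funM => //; apply: measurable_funB.
(* Putting the constraint [D] into the set lets the integrals run over the whole space, while [G] is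
   evaluated only where it is jointly measurable. *)
pose C : set (R * Rpow R d * Omega) :=
  [set t | D t.1.2 /\ q t.1.1 <= G t.1.2 t.2].
have mC : measurable C.
  have mD' : measurable [set t : R * Rpow R d * Omega | D t.1.2].
    rewrite -[X in measurable X]setTI.
    by apply: (measurableT_comp measurable_snd measurable_fst).
  have mGt : measurable_fun [set t : R * Rpow R d * Omega | D t.1.2]
      (fun t => G t.1.2 t.2).
    have mg : measurable_fun [set t : R * Rpow R d * Omega | D t.1.2]
        (fun t => (t.1.2, t.2)).
      apply: measurable_funTS; apply: measurable_fun_pair => //.
      exact: (measurableT_comp measurable_snd measurable_fst).
    have mDT : measurable (D `*` [set: Omega]) by exact: measurableX.
    apply: (measurable_comp mDT _ mG mg).
    by move=> _ [t Dt <-].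
  have mqt : measurable_fun [set t : R * Rpow R d * Omega | D t.1.2]
      (fun t => q t.1.1).
    apply: measurable_funTS; apply: (measurableT_comp mq).
    exact: (measurableT_comp measurable_fst measurable_fst).
  rewrite (_ : C = [set t | D t.1.2] `&`
      (fun t => q t.1.1 <= G t.1.2 t.2) @^-1` [set true])//.
  exact: measurable_fun_ler.
rewrite /J_prob; congr (`| _ - _ |%E).
transitivity (\int[Pn]_w \int[lebesgue_tuple R d]_x
    kappa' (G xnew w) (xsection C (G xnew w, x)))%E.
  apply: eq_integral => w _; rewrite /Gamma integral_mkcond.
  apply: eq_integral => x _; rewrite patchE.
  case: ifPn => [/set_mem Dx|/negP nDx].
    congr (kappa' _ _); rewrite xsectionE; apply/seteqP; split => w' //=.
    by case.
  rewrite (_ : xsection _ _ = set0) ?measure0// xsectionE.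
  by apply/seteqP; split => w' //= [Dx]; case: nDx; apply/mem_set.
rewrite (integral_conditional_law Pn (G xnew) kappa' (lebesgue_tuple R d) mGx
  kappa'P C mC).
rewrite [RHS]integral_mkcond.
apply: ge0_ae_eq_integral_nonmeasurable.
(* Measurability in [x] of the exceedance probability: it is the measure of the section of [C'] at
   [x]. *)
- pose C' : set (Rpow R d * Omega) := [set p | C ((G xnew p.2, p.1), p.2)].
  have mC' : measurable C'.
    rewrite -[X in measurable X]setTI.
    apply: (_ : measurable_fun setT
      (fun p : Rpow R d * Omega => ((G xnew p.2, p.1), p.2))) => //.
    apply: measurable_fun_pair => //; apply: measurable_fun_pair => //.
    exact: measurableT_comp.
  have := measurable_fun_xsection Pn mC'.
  by apply: eq_measurable_fun => x _; rewrite /= xsectionE.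
- by move=> x.
- move=> x; rewrite patchE; case: ifP => // _; rewrite lee_fin.
  rewrite !addr_ge0 ?Phi_ge0//.
  rewrite big_nat_cond; apply: sumr_ge0 => i /andP[iL _].
  by rewrite subr_ge0 Phi_le// ler_wpM2r ?sqrtr_ge0// ltW// Iincr.
(* Off the null set where some [var_W] may vanish, the integrands agree by [percentile_exceedance]
   inside [D], and both are 0 outside it. *)
- case: varW => N [mN N0 vN]; exists N; split => // x /= nE; apply: vN => /= H.
  apply: nE; rewrite patchE; case: ifPn => [/set_mem Dx|/negP nDx].
    rewrite -(percentile_exceedance Pn D G mn kn GPn k_sym xnew l alpha xMC
      L I jq Dnew snew DMC L1 effI x Dx (H Dx)).
    by congr (Pn _); apply/seteqP; split => w //= [].
  rewrite (_ : [set _ | _] = set0) ?measure0//.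
  by apply/seteqP; split => w' //= [Dx]; case: nDx; apply/mem_set.
Qed.
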